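(* Let $S \subseteq \mathbb{Z}^+$ be a set with upper density $1$, i.e. $\limsup_{n \to \infty} \frac{|S \cap [1,n]|}{n} = 1$. Then $S$ is infinitely walkable.
   Context: $\mathbb{Z}^+$ denotes the set of positive integers. A walk over a set $S \subseteq \mathbb{Z}^+$ is a finite or infinite sequence of integers $a_1, a_2, \dots$ such that $a_{i+1} - a_i \in S$ for all $i$ (for which $a_{i+1}$ is defined). For a positive integer $k$, the set $S$ is $k$-walkable if every coloring of $\mathbb{Z}$ with $k$ colors admits an infinitely long monochromatic walk over $S$. The set $S$ is infinitely walkable if it is $k$-walkable for all positive integers $k$. *)

(* Defs.v *)
From HB Require Import structures.
From mathcomp Require Import all_boot all_order all_algebra.
From mathcomp Require Import finmap.
From mathcomp Require Import all_classical all_reals all_analysis.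

Set Implicit Arguments.
Unset Strict Implicit.
Unset Printing Implicit Defensive.

Import Order.TTheory GRing.Theory Num.Theory.

Local Open Scope classical_set_scope.
Local Open Scope ring_scope.

Definition infinite_walk (S : set int) (a : nat -> int) : Prop :=
  forall i : nat, S (a i.+1 - a i).

Definition walkable (k : nat) (S : set int) : Prop :=
  forall c : int -> 'I_k, exists a : nat -> int,
    infinite_walk S a /\ exists col : 'I_k, forall i : nat, c (a i) = col.

Definition infinitely_walkable (S : set int) : Prop :=
  forall k : nat, (0 < k)%N -> walkable k S.

(* The intersection is always finite, so fset_set does not degenerate. *)
Definition count_upto (S : set int) (n : nat) : nat :=
  #|` fset_set (S `&` `[1%:Z, n%:Z]) |%fset.

(* The index n = 0 contributes 0 / 0 = 0, which does not affect the limsup. *)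
Definition upper_density (R : realType) (S : set int) : \bar R :=
  limn_esup (fun n : nat => ((count_upto S n)%:R / n%:R : R)%:E).

(* Main.v *)
Require Import Defs.
From HB Require Import structures.
From mathcomp Require Import all_boot all_order all_algebra.
From mathcomp Require Import finmap.
From mathcomp Require Import all_classical all_reals all_analysis.
From mathcomp Require Import zify.

Set Implicit Arguments.
Unset Strict Implicit.
Unset Printing Implicit Defensive.

Import Order.TTheory GRing.Theory Num.Theory.

Local Open Scope classical_set_scope.
Local Open Scope ring_scope.

(** If no walk over [S] stays forever in the color [i], then some integer [x_i]
    is a dead end for [i]: no element of [x_i + S] has color [i]
    ([walk_or_dead_end]).  If this happens for each of the finitely many colors,
    then an integer lying in every translate [x_i + S] can have no color at all.

    Such an integer exists because finitely many translates of a set of upper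
    density 1 always meet ([translates_meet]).  Indeed there are arbitrarily
    large [n] for which [S] misses only a small fraction of [1, n]
    ([sparse_gaps]), and on such an initial segment each translate misses at
    most a bounded number of further points ([gaps_shift]); so the translates
    together cannot miss all of [1, n]. *)

Definition gaps (S : set int) (n : nat) : nat :=
  count (fun t : nat => `[< ~ S t%:Z >]) (iota 1 n).

Lemma count_upto_gaps (S : set int) (n : nat) :
  (count_upto S n + gaps S n <= n)%N.
Proof.
rewrite /gaps; set p := fun t : nat => `[< S t%:Z >].
have -> : count (fun t : nat => `[< ~ S t%:Z >]) (iota 1 n)
          = count (predC p) (iota 1 n).
  by apply: eq_count => t /=; rewrite asbool_neg.
rewrite -[leqRHS](size_iota 1) -(count_predC p) leq_add2r.
rewrite -size_filter -(size_map Posz) /count_upto.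
apply: uniq_leq_size; first exact: fset_uniq.
have fin : finite_set (S `&` `[1%:Z, n%:Z]).
  apply: (@sub_finite_set _ _ [set` [seq Posz t | t <- iota 1 n]]);
    last exact: finite_seq.
  move=> z [_ /=]; rewrite in_itv /= => /andP[z1 zn].
  by apply/mapP; exists `|z|%N; [rewrite mem_iota; lia | lia].
move=> z; rewrite in_fset_set // inE => -[Sz /=].
rewrite in_itv /= => /andP[z1 zn].
have zE : z = `|z|%N :> int by lia.
apply/mapP; exists `|z|%N => //.
rewrite mem_filter mem_iota /p -zE; apply/andP; split; last by lia.
exact/asboolP.
Qed.

Lemma gaps_le (S : set int) (m n : nat) :
  (m <= n)%N -> (gaps S m <= gaps S n)%N.
Proof.
by move=> /subnKC <-; rewrite /gaps iotaD count_cat leq_addr.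
Qed.

(** Past [d], the gaps of the translate [d + S] are the gaps of [S] moved by
    [d]; the first [d] points are simply given up. *)
Lemma gaps_shift (S : set int) (d n : nat) :
  (count (fun t : nat => `[< ~ S (t%:Z - d%:Z)%R >]) (iota 1 n)
   <= d + gaps S n)%N.
Proof.
have [nd|dn] := leqP n d.
  apply: leq_trans (count_size _ _) _.
  by rewrite size_iota (leq_trans nd) ?leq_addr.
rewrite -{1}(subnKC (ltnW dn)) iotaD count_cat leq_add //.
  by apply: leq_trans (count_size _ _) _; rewrite size_iota.
rewrite addnC iotaDl count_map (leq_trans _ (gaps_le S (leq_subr d n))) //.
rewrite /gaps (@eq_count _ _ (fun t : nat => `[< ~ S t%:Z >])) // => t /=.
by rewrite PoszD addrAC subrr add0r.
Qed.

Lemma gaps_shifts (S : set int) (s : seq nat) (n : nat) :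
  (count (fun t : nat => has (fun d : nat => `[< ~ S (t%:Z - d%:Z)%R >]) s)
     (iota 1 n)
   <= sumn s + size s * gaps S n)%N.
Proof.
elim: s => [|d s IHs] /=; first by rewrite count_pred0.
rewrite mulSn addnACA.
apply: leq_trans (leq_add (gaps_shift S d n) IHs).
by rewrite -count_predUI leq_addr.
Qed.

(** If the gaps filled at least a fraction [1 / m] of [1, n] for all large
    [n], the upper density would be at most [1 - 1 / m]. *)
Lemma sparse_gaps (R : realType) (S : set int) (m N : nat) :
  upper_density R S = 1%:E ->
  exists2 n : nat, (N <= n)%N & (m * gaps S n < n)%N.
Proof.
move=> Sdens; apply: contrapT => dense.
(* [m.+1] keeps the fraction meaningful when [m] is 0. *)
have ratio n : (maxn N 1 <= n)%N ->
    (count_upto S n)%:R / n%:R <= 1 - m.+1%:R^-1 :> R.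
  rewrite geq_max => /andP[Nn n1].
  have gapsn : (n <= m.+1 * gaps S n)%N.
    rewrite leqNgt; apply/negP => lt; apply: dense; exists n => //.
    by apply: leq_ltn_trans lt; rewrite leq_mul2r leqnSn orbT.
  have n0 : 0 < n%:R :> R by rewrite ltr0n.
  have m0 : 0 < m.+1%:R :> R by rewrite ltr0n.
  rewrite ler_pdivrMr // mulrBl mul1r mulrC lerBrDr.
  apply: le_trans (_ : (count_upto S n)%:R + (gaps S n)%:R <= _).
    by rewrite lerD2l ler_pdivrMr // -natrM ler_nat mulnC.
  by rewrite -natrD ler_nat count_upto_gaps.
have : (upper_density R S <= (1 - m.+1%:R^-1 : R)%:E)%E.
  apply: le_trans (ereal_inf_lbound _) _.
    by exists [set n | (maxn N 1 <= n)%N]; [exact: nbhs_infty_ge|].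
  by apply: ge_ereal_sup => _ [n /= Nn <-]; rewrite lee_fin ratio.
by rewrite Sdens lee_fin lerBrDr gerDl invr_le0 lern0.
Qed.

(** On a suitable [1, n] the gaps of the translates are too few to cover
    everything.  Moving all translates to the right by the same amount [D]
    makes the shifts natural numbers, as the counting requires. *)
Lemma translates_meet (R : realType) (S : set int) (xs : seq int) :
  upper_density R S = 1%:E ->
  exists y : int, {in xs, forall x, S (y - x)}.
Proof.
move=> Sdens.
pose D := (\sum_(x <- xs) `|x|)%N.
have leD x : x \in xs -> (`|x| <= D)%N.
  by move=> xin; rewrite /D (big_rem x) //= leq_addr.
pose s := [seq `|(x + D%:Z)%R|%N | x <- xs].
(* Half of the interval pays for the discarded initial points, the other half
   for the gaps. *)
have [n nlarge ngaps] := sparse_gaps (2 * size s) (2 * sumn s).+1 Sdens.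
have : ~~ all (fun t : nat => has (fun d : nat => `[< ~ S (t%:Z - d%:Z)%R >]) s)
          (iota 1 n).
  rewrite all_count size_iota neq_ltn; apply/orP; left.
  by apply: leq_ltn_trans (gaps_shifts S s n) _; lia.
rewrite -has_predC => /hasP[t _ /= /hasPn tS].
exists (t%:Z - D%:Z) => x xin.
have /tS/asboolPn/contrapT : `|(x + D%:Z)%R|%N \in s by exact: map_f.
by congr S; have := leD x xin; lia.
Qed.

(** The dead end [x] may have any color: if every integer, of whatever color,
    had a successor colored [i], iterating a choice of successors would give
    the walk. *)
Lemma walk_or_dead_end (k : nat) (S : set int) (c : int -> 'I_k) (i : 'I_k) :
  (exists2 a : nat -> int, infinite_walk S a & forall n, c (a n) = i) \/
  (exists x : int, forall y, S (y - x) -> c y <> i).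
Proof.
have [|nodead] := pselect (exists x : int, forall y, S (y - x) -> c y <> i).
  by right.
left.
have next x : exists y, S (y - x) /\ c y = i.
  apply: contrapT => stuck; apply: nodead; exists x => y Sy cy.
  by apply: stuck; exists y.
have [f fP] := choice next.
exists (fun n => iter n.+1 f 0) => n; first exact: (fP _).1.
exact: (fP _).2.
Qed.

Theorem theorem3p1 (R : realType) (S : set int)
    (Spos : S `<=` [set z : int | 0 < z])
    (Sdens : upper_density R S = 1%:E) :
  infinitely_walkable S.
Proof.
move=> k _ c; apply: contrapT => nowalk.
have dead i : exists x : int, forall y, S (y - x) -> c y <> i.
  have [[a aS ac]|//] := walk_or_dead_end S c i.
  by exfalso; apply: nowalk; exists a; split=> //; exists i.
have [x xP] := choice dead.
have [y yP] := translates_meet (codom x) Sdens.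
exact: (xP (c y) y (yP _ (codom_f x _)) erefl).
Qed.
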